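(* Let $\ell>1$ and $m>1$ be coprime odd integers. Let $t$ be an integer such that $t\equiv-1\pmod{\ell}$ and $t\equiv1\pmod{m}$, and set $S=\{1,-1,t,-t\}\subseteq\mathbb{Z}_{\ell m}$ (elements taken modulo $\ell m$). Then the Cayley graph $\mathrm{Cay}(\mathbb{Z}_{\ell m},S)$ is connected, arc-transitive and stable, and its adjacency matrix is compatible.
   Context: All graphs are finite, simple and undirected. For a group $G$ and a nonempty inverse-closed subset $S$ of $G\setminus\{1\}$, the Cayley graph $\mathrm{Cay}(G,S)$ has vertex set $G$, with $x,y$ adjacent if and only if $yx^{-1}\in S$. A graph is arc-transitive if its automorphism group acts transitively on its set of arcs (ordered pairs of adjacent vertices). The canonical double cover $\mathrm{D}(\Gamma)$ of a graph $\Gamma$ is the graph with vertex set $V(\Gamma)\times\mathbb{Z}_2$ in which $(u,x)$ and $(v,y)$ are adjacent if and only if $u$ and $v$ are adjacent in $\Gamma$ and $x\neq y$. The graph $\Gamma$ is called stable if $\mathrm{Aut}(\mathrm{D}(\Gamma))\cong\mathrm{Aut}(\Gamma)\times\mathbb{Z}_2$. The adjacency matrix $A$ of a graph is called compatible if there is a nonidentity permutation matrix $P$ of the same size as $A$ such that $AP$ is the adjacency matrix of some (simple, undirected) graph, i.e. $AP$ is a symmetric $(0,1)$-matrix with zero diagonal. This property does not depend on the ordering of the vertices used to form $A$. *)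

(* Defs.v *)
From HB Require Import structures.
From mathcomp Require Import all_boot all_order all_algebra all_fingroup.

Set Implicit Arguments.
Unset Strict Implicit.
Unset Printing Implicit Defensive.

Import GRing.Theory Num.Theory.
Local Open Scope ring_scope.

(* A finite simple undirected graph is given by its adjacency relation on a   *)
(* finite type of vertices.                                                   *)
Definition simple_graph (T : finType) (e : rel T) : Prop :=
  symmetric e /\ irreflexive e.

Definition graph_connected (T : finType) (e : rel T) : Prop :=
  forall x y : T, connect e x y.

Definition graph_aut (T : finType) (e : rel T) : {set {perm T}} :=
  [set s : {perm T} | [forall x, forall y, e (s x) (s y) == e x y]].

Lemma graph_autP (T : finType) (e : rel T) (s : {perm T}) :
  reflect (forall x y, e (s x) (s y) = e x y) (s \in graph_aut e).
Proof.
rewrite inE; apply: (iffP 'forall_'forall_eqP) => h x y; exact: h.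
Qed.

Lemma graph_aut_group_set (T : finType) (e : rel T) :
  group_set (graph_aut e).
Proof.
apply/group_setP; split=> [|s s' /graph_autP hs /graph_autP hs'].
  by apply/graph_autP=> x y; rewrite !perm1.
by apply/graph_autP=> x y; rewrite !permM hs' hs.
Qed.

Canonical graph_aut_group (T : finType) (e : rel T) : {group {perm T}} :=
  Group (graph_aut_group_set e).

Definition arc_transitive (T : finType) (e : rel T) : Prop :=
  forall x y u v : T, e x y -> e u v ->
    exists2 s : {perm T}, s \in graph_aut e & s x = u /\ s y = v.

Definition double_cover (T : finType) (e : rel T) : rel (T * 'Z_2) :=
  fun p q => e p.1 q.1 && (p.2 != q.2).

Lemma double_cover_simple (T : finType) (e : rel T) :
  simple_graph e -> simple_graph (double_cover e).
Proof.
case=> sym_e irr_e; split=> [p q|p]; rewrite /double_cover.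
  by rewrite sym_e eq_sym.
by rewrite irr_e.
Qed.

(* [set: 'Z_2] is the additive group of integers modulo 2, and setX is the    *)
(* external direct product.                                                   *)
Definition stable (T : finType) (e : rel T) : Prop :=
  graph_aut (double_cover e) \isog setX (graph_aut e) [set: 'Z_2].

(* Rows and columns follow the canonical enumeration of the vertices.         *)
Definition adjacency_mx (T : finType) (e : rel T) : 'M[int]_#|T| :=
  \matrix_(i, j) (e (enum_val i) (enum_val j))%:R.

Definition is_adjacency_mx (n : nat) (B : 'M[int]_n) : Prop :=
  exists2 f : rel 'I_n, simple_graph f & B = \matrix_(i, j) (f i j)%:R.

Definition compatible_mx (n : nat) (A : 'M[int]_n) : Prop :=
  exists P : 'M[int]_n,
    [/\ is_perm_mx P, P != 1%:M & is_adjacency_mx (A *m P)].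

Definition connection_set (gT : finGroupType) (S : {set gT}) : Prop :=
  [/\ S != set0, 1%g \notin S & forall x, x \in S -> x^-1%g \in S].

Definition cayley (gT : finGroupType) (S : {set gT}) : rel gT :=
  fun x y => (y * x^-1)%g \in S.

Lemma cayley_simple (gT : finGroupType) (S : {set gT}) :
  connection_set S -> simple_graph (cayley S).
Proof.
case=> _ S1 SV; split=> [x y|x]; rewrite /cayley.
  by apply/idP/idP=> /SV; rewrite invMg invgK.
by rewrite mulgV; apply/negbTE.
Qed.

Lemma connection_set_lm (l m : nat) (t : int) :
  (1 < l)%N -> (1 < m)%N -> (t = 1 %[mod m])%Z ->
  connection_set [set 1; -1; t%:~R; - t%:~R : 'Z_(l * m)].
Proof.
move=> l1 m1 tm.
have t0 : t%:~R != 0 :> 'Z_(l * m).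
  have lm1 : (1 < l * m)%N by rewrite (leq_trans m1) // leq_pmull // ltnW.
  have int0 (z : int) : z%:~R = 0 :> 'Z_(l * m) -> (m %| z)%Z.
    move=> hz; have {hz} : (`|z|%N)%:R = 0 :> 'Z_(l * m).
      apply/eqP; case: z hz => k /= hz; first by rewrite -hz.
      by move/eqP: hz; rewrite NegzE mulrNz oppr_eq0.
    move/(congr1 val); rewrite /= val_Zp_nat // => /eqP /(dvdn_trans _) h.
    by rewrite /dvdz; apply: h; rewrite dvdn_mull.
  apply/eqP=> /int0 /dvdz_mod0P h; move: tm; rewrite h => /esym/eqP.
  by rewrite -/(_ %| _)%Z; case: m m1 {int0 h lm1} => [|[|m]].
have e1 : (1%g : 'Z_(l * m)) = 0 by [].
have eV (x : 'Z_(l * m)) : x^-1%g = - x by [].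
split.
- by apply/set0Pn; exists 1; rewrite !inE eqxx.
- rewrite e1 !inE !negb_or ![0 == _]eq_sym !oppr_eq0 oner_eq0 /=.
  by rewrite t0.
move=> x; rewrite eV !inE -!orbA => /or4P[] /eqP->; rewrite ?opprK eqxx ?orbT //.
Qed.

(* Main.v *)
Require Import Defs.
From mathcomp Require Import all_boot all_order all_algebra all_fingroup.
From mathcomp Require Import ring.
Set Implicit Arguments.
Unset Strict Implicit.
Unset Printing Implicit Defensive.
Import GRing.Theory.
Local Open Scope ring_scope.

(** Write [n] for the odd number [l * m] and [tau] for the class of [t] modulo
    [n].  As [t] is -1 modulo [l] and 1 modulo [m], [tau] is a square root of 1
    other than 1 and -1.  The proof is about such a square root: [S] is then the
    set {1, -1, tau, -tau}, a multiplicative group of exponent 2.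

    Connectedness holds because 1 is in [S].  The maps z |-> c(z - x) + u with
    [c] in [S] are automorphisms, and since [S] is a multiplicative group they
    can send any arc to any other ([sqrt1_arc_transitive]).

    For stability, any two elements of [S] that add up to 2 are both equal to 1
    ([sqrt1_sum_two]), so [x + 1] is the only common neighbour of [x] and
    [x + 2].  Conversely, in a Cayley graph of an abelian group, if [y] is the
    only common neighbour of [x] and [w], then [x], [y], [w] is an arithmetic
    progression.  Being the only common neighbour is preserved by automorphisms,
    so an automorphism of the double cover is determined on the walk
    (0, 0), (1, 1), (2, 0), (3, 1), ... by its values at the first two vertices.
    The modulus being odd, this walk visits every vertex; hence an automorphism
    of the double cover is determined by the image of one arc
    ([cover_aut_eq]).  By arc-transitivity that image is also attained by an
    automorphism lifted from the base graph, so every automorphism of the double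
    cover is such a lift ([stable_cayley]).

    For compatibility, permute the columns by multiplication by [tau].  The
    relation [tau y - x \in S] is symmetric because [S] is stable under [tau]
    and [tau ^+ 2 = 1]; it is irreflexive because elements of [S] are units
    whereas [tau - 1] is a zero divisor ([sqrt1_compatible]). *)

(** * Automorphisms lifted to the canonical double cover *)

Section Lift.
Variables (T : finType) (e : rel T).

Definition cover_lift_fun (u : {perm T} * 'Z_2) (p : T * 'Z_2) : T * 'Z_2 :=
  (u.1 p.1, p.2 + u.2).

Lemma cover_lift_fun_inj u : injective (cover_lift_fun u).
Proof.
move=> [x i] [y j] eq_xy; congr (_, _).
  exact: perm_inj (congr1 fst eq_xy).
exact: addIr (congr1 snd eq_xy).
Qed.

Definition cover_lift u : {perm T * 'Z_2} := perm (@cover_lift_fun_inj u).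

Lemma cover_liftM :
  {in setX (graph_aut e) [set: 'Z_2] &,
    {morph cover_lift : u v / (u * v)%g}}.
Proof.
move=> u v _ _; apply/permP=> p; rewrite permM !permE /cover_lift_fun /=.
by rewrite permM addrA.
Qed.

Canonical cover_lift_morphism := Morphism cover_liftM.

Lemma cover_lift_injm (x0 : T) : ('injm cover_lift_morphism)%g.
Proof.
apply/injmP=> -[s i] [s' i'] _ _ /permP eq_lift.
have eqs x : cover_lift_fun (s, i) (x, 0) = cover_lift_fun (s', i') (x, 0).
  by have := eq_lift (x, 0); rewrite !permE.
congr (_, _); first by apply/permP=> y; have := congr1 fst (eqs y).
by have := congr1 snd (eqs x0); rewrite /= !add0r.
Qed.

Lemma cover_lift_aut u :
  u.1 \in graph_aut e -> cover_lift u \in graph_aut (double_cover e).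
Proof.
move=> /graph_autP aut_u; apply/graph_autP=> p q.
by rewrite !permE /double_cover /= aut_u (inj_eq (addIr _)).
Qed.

(** Over a nonempty vertex set, lifting embeds [graph_aut e] times Z_2 into the
    automorphism group of the double cover, so stability follows once the
    embedding is onto. *)
Lemma stable_of_lifts (x0 : T) :
    (forall f, f \in graph_aut (double_cover e) ->
       exists2 u, u.1 \in graph_aut e & f = cover_lift u) ->
  stable e.
Proof.
move=> all_lifts; rewrite /stable isog_sym; apply/isogP.
exists cover_lift_morphism; first exact: cover_lift_injm.
rewrite morphimEdom; apply/setP=> f; apply/imsetP/idP.
  by case=> u; rewrite inE => /andP[aut_u _] ->; apply: cover_lift_aut.
by case/all_lifts=> u aut_u ->; exists u => //; rewrite inE aut_u inE.
Qed.

End Lift.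

(** * Unique common neighbours *)

Section OnlyCommon.
Variables (T : finType) (e : rel T).

(** In an abelian Cayley graph this forces [x], [y], [w] to be consecutive on a
    straight line.  Being defined from adjacency alone, it is preserved by
    automorphisms. *)
Definition only_common_neighbour (x y w : T) : Prop :=
  [/\ e x y, e y w & forall z, e x z -> e z w -> z = y].

Lemma only_common_neighbour_aut (f : {perm T}) x y w :
    f \in graph_aut e -> only_common_neighbour x y w ->
  only_common_neighbour (f x) (f y) (f w).
Proof.
move=> /graph_autP aut_f [exy eyw only_y]; split; rewrite ?aut_f // => z.
by rewrite -[z](permKV f) !aut_f => exz ezw; rewrite (only_y _ exz ezw).
Qed.

End OnlyCommon.

Lemma Z2_neq_neq (i j k : 'Z_2) : i != j -> j != k -> k = i.
Proof.
by move: i j k; do 3![case=> [[|[|//]] ?]] => //= _ _; apply: val_inj.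
Qed.

(** * Stability of Cayley graphs of cyclic groups of odd order *)

Section CyclicCayley.
Variables (gT : finGroupType) (S : {set gT}) (a : gT).
Hypothesis abelG : abelian [set: gT].
Hypothesis genG : <[a]>%g = [set: gT].
Hypothesis Sa : a \in S.

Let e := cayley S.

Let mulC (x y : gT) : (x * y = y * x)%g.
Proof. by apply: (centsP abelG); rewrite inE. Qed.

Lemma cayley_connected : graph_connected e.
Proof.
move=> x y; have: (y * x^-1)%g \in <[a]>%g by rewrite genG inE.
case/cycleP=> k /(canRL (mulgKV _)) ->; elim: k => [|k IHk].
  by rewrite mul1g.
apply: connect_trans IHk (connect1 _).
by rewrite /e /cayley invMg expgS !mulgA mulgK mulgK.
Qed.

(** If [x] reaches [w] by multiplying by [s] and then by [s'], it also does so by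
    [s'] and then [s]; a unique middle vertex forces [s = s'].  Thus the third
    vertex is a function of the first two. *)
Lemma cover_only_common p q r :
    only_common_neighbour (double_cover e) p q r ->
  r = (q.1 * p.1^-1 * q.1, p.2)%g.
Proof.
case: p q r => [x i] [y j] [w k] [/andP[/= xy ij] /andP[/= yw jk] only_y].
rewrite (Z2_neq_neq ij jk); congr (_, _).
have: (w * y^-1 * x, j)%g = (y, j).
  (* the middle vertex of the path that takes the two steps in reverse order *)
  apply: only_y; rewrite /double_cover /e /cayley /=.
    by rewrite mulgK; apply/andP.
  by rewrite jk andbT !invMg invgK !mulgA (mulC _ w^-1)%g !mulgA
             mulVg mul1g mulC.
move=> /(congr1 fst) /= eq_y.
by rewrite -{1}eq_y mulgK mulgKV.
Qed.

Hypothesis odd_a : odd #[a]%g.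
(** With [s = s' = a] the only way to write [a * a] as a product of two elements
    of [S], [a ^+ k.+1] is the only common neighbour of [a ^+ k] and
    [a ^+ k.+2]. *)
Hypothesis aa_uniq : {in S &, forall s s', (s * s' = a * a -> s = a)%g}.

Definition cover_walk k : gT * 'Z_2 := (a ^+ k, k%:R)%g.

Lemma only_common_cover_walk k :
  only_common_neighbour (double_cover e)
    (cover_walk k) (cover_walk k.+1) (cover_walk k.+2).
Proof.
have neqS (i : 'Z_2) : i != i + 1 by rewrite -subr_eq0 opprD addNKr.
have walkS i : double_cover e (cover_walk i) (cover_walk i.+1).
  by rewrite /double_cover /e /cayley /= expgS mulgK Sa -natr1 neqS.
split=> // -[z j] /andP[/= xz kj] /andP[/= zw jk].
congr (_, _).
  apply/(mulIg (a ^+ k)^-1%g); rewrite expgS mulgK.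
  apply: aa_uniq xz zw _; rewrite mulC mulgA mulgKV.
  by rewrite !expgS !mulgA mulgK.
by apply: Z2_neq_neq kj; rewrite -natr1 eq_sym.
Qed.

(** Since [a] has odd order [n], the exponents [k] and [k + n] give the same
    element but have opposite parities. *)
Lemma cover_walk_surj p : exists k, p = cover_walk k.
Proof.
case: p => x i; have: x \in <[a]>%g by rewrite genG inE.
case/cycleP=> k ->; have [<-|neq_ki] := eqVneq k%:R i; first by exists k.
exists (k + #[a]%g)%N; rewrite /cover_walk expgD expg_order mulg1.
congr (_, _); apply: Z2_neq_neq neq_ki.
have odd1 : #[a]%g%:R = 1 :> 'Z_2.
  by apply: val_inj; rewrite /= val_Zp_nat // modn2 odd_a.
by rewrite natrD odd1 -subr_eq0 addrAC subrr add0r.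
Qed.

(** Along the walk each vertex is determined by its two predecessors in a way that
    automorphisms preserve, and the walk visits every vertex. *)
Lemma cover_aut_eq (f g : {perm gT * 'Z_2}) :
    f \in graph_aut (double_cover e) -> g \in graph_aut (double_cover e) ->
    f (1%g, 0) = g (1%g, 0) -> f (a, 1) = g (a, 1) -> f = g.
Proof.
move=> aut_f aut_g fg0 fg1; apply/permP=> p; have [k ->] := cover_walk_surj p.
(* two consecutive vertices are needed to carry the induction *)
suff: f (cover_walk k) = g (cover_walk k)
      /\ f (cover_walk k.+1) = g (cover_walk k.+1) by case.
elim: k => [|k [IHk IHk1]]; first by rewrite /cover_walk expg0 expg1.
split=> //; have walkP := only_common_cover_walk k.
rewrite (cover_only_common (only_common_neighbour_aut aut_f walkP)).
rewrite (cover_only_common (only_common_neighbour_aut aut_g walkP)).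
by rewrite IHk IHk1.
Qed.

(** An automorphism of the double cover sends the arc from (1, 0) to (a, 1) to an
    arc lying over some arc of the base graph, and a lift achieves the same. *)
Lemma stable_cayley : arc_transitive e -> stable e.
Proof.
move=> arcT; apply: (@stable_of_lifts _ _ 1%g) => f aut_f.
have: double_cover e (f (1%g, 0)) (f (a, 1)).
  by rewrite (graph_autP _ _ aut_f) /double_cover /e /cayley /= invg1 mulg1 Sa.
case Df0: (f (1%g, 0)) => [u i]; case Df1: (f (a, 1)) => [v j].
case/andP=> /= euv ij; have e1a : e 1%g a by rewrite /e /cayley invg1 mulg1.
have [s aut_s [s1 sa]] := arcT _ _ _ _ e1a euv.
exists (s, i) => //; apply: cover_aut_eq => //; first exact: cover_lift_aut.
  by rewrite Df0 permE /cover_lift_fun /= s1 add0r.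
rewrite Df1 permE /cover_lift_fun /= sa; congr (_, _).
by apply: Z2_neq_neq ij; rewrite -subr_eq0 addrK.
Qed.

End CyclicCayley.

(** * Compatibility from a permutation of the vertices *)

(** Permuting the columns of the adjacency matrix by [p] yields the matrix of the
    relation [e x (p y)]. *)
Lemma compatible_of_perm (T : finType) (e : rel T) (p : {perm T}) :
    p != 1%g -> simple_graph (fun x y => e x (p y)) ->
  compatible_mx (adjacency_mx e).
Proof.
move=> p_neq1 [sym_ep irr_ep].
have rank_inj : injective (fun i : 'I_#|T| => enum_rank (p (enum_val i))).
  move=> i j eq_ij; apply: enum_val_inj; apply: (@perm_inj _ p).
  exact: enum_rank_inj eq_ij.
(* [A *m perm_mx s] has entries [A i (s^-1 j)], whence the inverse *)
pose q := perm rank_inj; exists (perm_mx q^-1%g); split.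
- exact: perm_mx_is_perm.
- apply: contraNneq p_neq1 => q1; apply/eqP/permP=> x; rewrite perm1.
  have /permP/(_ (enum_rank x)) : q = 1%g.
    apply/permP=> i; rewrite perm1; apply/eqP.
    have /matrixP/(_ (q i) i) := q1.
    by rewrite !mxE permK eqxx; case: eqP.
  by rewrite permE perm1 enum_rankK => /enum_rank_inj.
exists (fun i j => e (enum_val i) (p (enum_val j))).
  by split=> [i j|i]; [apply: sym_ep | apply: irr_ep].
rewrite -col_permE; apply/matrixP=> i j.
by rewrite !mxE permE enum_rankK.
Qed.

(** * The Cayley graph on 1, -1 and two further square roots of 1 *)

Section Sqrt1Cayley.
Variables (n : nat) (tau : 'Z_n).
Hypotheses (n_gt1 : (1 < n)%N) (n_odd : odd n).
Hypotheses (tau2 : tau * tau = 1) (tau_neq1 : tau != 1) (tau_neqN1 : tau != -1).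

Let S : {set 'Z_n} := [set 1; -1; tau; - tau].

Lemma sqrt1_sqr s : s \in S -> s * s = 1.
Proof.
by rewrite !inE -!orbA => /or4P[]/eqP->; rewrite ?mulrNN ?mulr1 ?tau2.
Qed.

Lemma sqrt1_mul : {in S &, forall s s', s * s' \in S}.
Proof.
move=> s s'; rewrite !inE -!orbA => /or4P[]/eqP-> /or4P[]/eqP->;
  by rewrite ?(mulrNN, mulrN, mulNr, mul1r, mulr1, tau2, opprK, eqxx, orbT).
Qed.

Lemma sqrt1_opp s : s \in S -> - s \in S.
Proof. by move/(sqrt1_mul _); rewrite -mulN1r; apply; rewrite !inE eqxx orbT. Qed.

Lemma sqrt1_mulK s : s \in S -> involutive ( *%R s).
Proof. by move=> Ss z; rewrite mulrA sqrt1_sqr ?mul1r. Qed.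

Lemma cayley_ringE x y : cayley S x y = (y - x \in S).
Proof. by []. Qed.

(** If [s' = 2 - s] and both have square 1, then [4 s = 4 + s^2 - s'^2 = 4], and 4
    is invertible modulo an odd number. *)
Lemma sqrt1_sum_two : {in S &, forall s s', s + s' = 1 + 1 -> s = 1}.
Proof.
move=> s s' Ss Ss' /(canRL (addKr _)) s'E.
have four_unit : (4%:R : 'Z_n) \is a GRing.unit.
  by rewrite unitZpE // (coprimeXr 2 (n := 2)) // coprimen2.
apply: (mulrI four_unit).
transitivity (4%:R + (s * s - s' * s')); first by rewrite s'E; ring.
by rewrite !sqrt1_sqr // subrr addr0 mulr1.
Qed.

Lemma sqrt1_arc_transitive : arc_transitive (cayley S).
Proof.
move=> x y u v; rewrite !cayley_ringE => Sxy Suv.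
(* the quotient of [v - u] by [y - x], which is its own inverse *)
pose c := (v - u) * (y - x).
have Sc : c \in S by apply: sqrt1_mul.
have c_inj : injective (fun z => c * (z - x) + u).
  by move=> z z' /addIr /(inv_inj (sqrt1_mulK Sc)) /addIr.
exists (perm c_inj); last first.
  by rewrite !permE subrr mulr0 add0r /c -mulrA sqrt1_sqr // mulr1 subrK.
apply/graph_autP=> z z'; rewrite !cayley_ringE !permE.
have -> : c * (z' - x) + u - (c * (z - x) + u) = c * (z' - z) by ring.
by apply/idP/idP=> [/(sqrt1_mul Sc)|/(sqrt1_mul Sc)//]; rewrite sqrt1_mulK.
Qed.

(** Right multiplication of the adjacency matrix by the permutation matrix of
    z |-> tau z gives the relation [tau y - x \in S].  A loop at [x] would make
    [(tau - 1) x] an element of [S], hence invertible, although it is killed by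
    [tau + 1], which is nonzero. *)
Lemma sqrt1_compatible : compatible_mx (adjacency_mx (cayley S)).
Proof.
have Stau : tau \in S by rewrite !inE eqxx !orbT.
have tauK := sqrt1_mulK Stau; have tau_inj := inv_inj tauK.
apply: (@compatible_of_perm _ _ (perm tau_inj)).
  apply: contraNneq tau_neq1 => /permP/(_ 1).
  by rewrite permE perm1 mulr1 => ->.
have symS x y : tau * y - x \in S -> tau * x - y \in S.
  move=> /(sqrt1_mul Stau) /sqrt1_opp.
  by rewrite mulrBr mulrA tau2 mul1r opprB.
split=> [x y|x]; rewrite !cayley_ringE !permE.
  by apply/idP/idP; apply: symS.
apply/negP=> /sqrt1_sqr loop_sqr; case/eqP: tau_neqN1.
have : (tau + 1) * ((tau * x - x) * (tau * x - x)) = 0.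
  by ring: tau2.
by rewrite loop_sqr mulr1 => /eqP; rewrite addr_eq0 => /eqP.
Qed.

Lemma sqrt1_stable : stable (cayley S).
Proof.
apply: (@stable_cayley _ S Zp1).
- exact: FinRing.zmod_abelian.
- exact/esym/Zp_cycle.
- by rewrite !inE eqxx.
- by rewrite (order_Zp1 _) Zp_cast.
- exact: sqrt1_sum_two.
- exact: sqrt1_arc_transitive.
Qed.

End Sqrt1Cayley.

(** * The class of t modulo l m *)

Lemma intr_Zp_eq0 n (z : int) : (1 < n)%N -> (z%:~R == 0 :> 'Z_n) = (n %| z)%Z.
Proof.
move=> n_gt1; rewrite /dvdz absz_nat.
have nat0 k : (k%:R == 0 :> 'Z_n) = (n %| k)%N.
  by rewrite -val_eqE /= val_Zp_nat.
by case: z => k; rewrite ?NegzE ?mulrNz ?oppr_eq0 nat0.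
Qed.

Theorem theorem1p8 (l m : nat) (t : int)
    (l_gt1 : (1 < l)%N) (m_gt1 : (1 < m)%N)
    (l_odd : odd l) (m_odd : odd m) (lm_coprime : coprime l m)
    (t_mod_l : (t = -1 %[mod l])%Z) (t_mod_m : (t = 1 %[mod m])%Z) :
  let S : {set 'Z_(l * m)} := [set 1; -1; t%:~R; - t%:~R] in
  [/\ graph_connected (cayley S), arc_transitive (cayley S),
      stable (cayley S) & compatible_mx (adjacency_mx (cayley S))].
Proof.
move=> S.
have lm_gt1 : (1 < l * m)%N by rewrite (leq_trans m_gt1) // leq_pmull // ltnW.
have lm_odd : odd (l * m) by rewrite oddM l_odd.
have l_t : (l %| t + 1)%Z.
  by move/eqP: t_mod_l; rewrite eqz_mod_dvd opprK.
have m_t : (m %| t - 1)%Z by move/eqP: t_mod_m; rewrite eqz_mod_dvd.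
have odd_ndvd2 d : (1 < d)%N -> odd d -> ~~ (d %| 2)%Z.
  move=> d_gt1 d_odd; apply/negP=> /(@dvdn_leq d 2 isT).
  by case: d d_gt1 d_odd => [|[|[|]]].
have dvd_lm (z : int) :
    z%:~R == 0 :> 'Z_(l * m) -> (l %| z)%Z /\ (m %| z)%Z.
  rewrite intr_Zp_eq0 // => lm_z.
  by split; apply: dvdz_trans lm_z; [apply: dvdn_mulr | apply: dvdn_mull].
have tt : (t%:~R : 'Z_(l * m)) * t%:~R = 1.
  apply/eqP; rewrite -subr_eq0 -intrM -(intrB _ _ 1) intr_Zp_eq0 //.
  have -> : t * t - 1 = (t + 1) * (t - 1) by ring.
  by rewrite PoszM; apply: dvdz_mul l_t m_t.
(* if [t] were also 1 modulo [l], or also -1 modulo [m], then that modulus would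
   divide both [t + 1] and [t - 1], hence 2 *)
have t_neq1 : t%:~R != 1 :> 'Z_(l * m).
  rewrite -subr_eq0 -(intrB _ _ 1).
  apply/negP=> /dvd_lm[l_t1 _]; case/negP: (odd_ndvd2 _ l_gt1 l_odd).
  have -> : 2 = (t + 1) - (t - 1) :> int by ring.
  exact: rpredB.
have t_neqN1 : t%:~R != -1 :> 'Z_(l * m).
  rewrite -subr_eq0 opprK -(intrD _ _ 1).
  apply/negP=> /dvd_lm[_ m_t1]; case/negP: (odd_ndvd2 _ m_gt1 m_odd).
  have -> : 2 = (t + 1) - (t - 1) :> int by ring.
  exact: rpredB.
split.
- apply: (@cayley_connected _ S Zp1); last by rewrite !inE eqxx.
  exact/esym/Zp_cycle.
- exact: sqrt1_arc_transitive.
- exact: sqrt1_stable.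
- exact: sqrt1_compatible.
Qed.
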